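(* Let $G$ be a $(d,k)$-digraph with self-repeats whose permutation cycle structure is $2$-critical. Then $\mathrm{ord}_r(v)\leq d-1$ for every vertex $v$ of $G$.
   Context: A $(d,k)$-digraph (almost Moore digraph) is a finite digraph, diregular of degree $d>1$ (every vertex has in- and out-degree $d$), of diameter $k>1$ and order $N=d+d^2+\cdots+d^k$. Every vertex $v$ has a unique vertex $r(v)$ (its repeat) such that there are exactly two walks of length $\leq k$ from $v$ to $r(v)$, at least one of them of length $k$; $r$ is a permutation of $V(G)$ and an automorphism of $G$. A self-repeat is a vertex with $r(v)=v$. $\mathrm{ord}_r(v)$ is the least $t\geq1$ with $r^t(v)=v$. The permutation cycle structure of $G$ is the vector $(m_1,m_2,\ldots,m_N)$ where $m_n$ is the number of cycles of length $n$ in the disjoint cycle decomposition of $r$. A permutation cycle structure $(m_1,\ldots,m_N)$ is $2$-critical if there exists a unique integer $\alpha>1$ for which the indices $j>1$ with $m_j\neq 0$ are those of the form $j=2^t\alpha$ for some integer $t\geq 0$. *)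

(* Defs.v *)
From mathcomp Require Import all_boot all_fingroup.

Set Implicit Arguments.
Unset Strict Implicit.
Unset Printing Implicit Defensive.

(* A digraph on T is a relation e : rel T. Loops are not excluded, but a       *)
(* (d,k)-digraph has none: a loop at v would give at least three walks of      *)
(* length <= 2 from v to v, whereas nwalks_le_bounds below allows only two.    *)

Section Walks.
Variables (T : finType) (e : rel T).

Definition is_walk (u v : T) (p : seq T) : bool := path e u p && (last u p == v).

Definition nwalks (l : nat) (u v : T) : nat :=
  #|[set p : l.-tuple T | is_walk u v p]|.

Definition nwalks_le (k : nat) (u v : T) : nat :=
  \sum_(0 <= l < k.+1) nwalks l u v.

Definition is_dist (u v : T) (n : nat) : Prop :=
  (exists2 p, is_walk u v p & size p = n) /\
  (forall p, is_walk u v p -> n <= size p).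

Definition has_diameter (k : nat) : Prop :=
  (forall u v, exists2 n, is_dist u v n & n <= k) /\
  (exists u v, is_dist u v k).

Definition diregular (d : nat) : Prop :=
  forall v, #|[set w | e v w]| = d /\ #|[set u | e u v]| = d.

Record dk_digraph (d k : nat) : Prop := DkDigraph {
  dk_degree_gt1 : 1 < d;
  dk_diameter_gt1 : 1 < k;
  dk_diregular : diregular d;
  dk_diameter : has_diameter k;
  dk_order : #|T| = \sum_(1 <= i < k.+1) d ^ i
}.

Definition is_repeat (k : nat) (v w : T) : bool :=
  (nwalks_le k v w == 2) && (0 < nwalks k v w).

(* The default value v is never used in a (d,k)-digraph: see repeatP. *)
Definition repeat (k : nat) (v : T) : T := odflt v [pick w | is_repeat k v w].

End Walks.

Section RepeatPermutation.
Variables (T : finType) (e : rel T).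

Lemma nwalks0 u v : nwalks e 0 u v = (u == v).
Proof.
rewrite /nwalks; have [<-|neq] := eqVneq u v.
  rewrite (_ : [set p | _] = setT) ?cardsT ?card_tuple //.
  by apply/setP=> p; rewrite !inE tuple0 /is_walk /= eqxx.
apply/eqP; rewrite cards_eq0; apply/eqP/setP=> p.
by rewrite !inE tuple0 /is_walk /= (negPf neq).
Qed.

Lemma nwalksS l u v : nwalks e l.+1 u v = \sum_(w | e u w) nwalks e l w v.
Proof.
rewrite /nwalks -sum1_card.
rewrite (partition_big (fun p : l.+1.-tuple T => thead p) (e u)) /=; last first.
  by move=> p; rewrite inE /is_walk (tuple_eta p) /= theadE => /andP[/andP[]].
apply: eq_bigr => w euw; rewrite -sum1_card.
rewrite (reindex_onto (fun q : l.-tuple T => [tuple of w :: q])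
           (fun p : l.+1.-tuple T => [tuple of behead p])) /=; last first.
  move=> p /andP[_ /eqP <-]; rewrite [RHS]tuple_eta; exact: val_inj.
apply: eq_bigl => q; rewrite !inE theadE eqxx /is_walk /= euw /= andbT.
suff -> : [tuple of behead [tuple of w :: q]] = q by rewrite eqxx andbT.
exact: val_inj.
Qed.

Lemma sum_walks_from d l u : diregular e d -> \sum_v nwalks e l u v = d ^ l.
Proof.
move=> reg; elim: l u => [|l IHl] u.
  under eq_bigr do rewrite nwalks0.
  by rewrite (bigD1 u) //= eqxx big1 // => v; rewrite eq_sym => /negPf->.
under eq_bigr do rewrite nwalksS.
rewrite exchange_big /= (eq_bigr _ (fun w _ => IHl w)) sum_nat_const expnS.
by rewrite -(reg u).1 cardsE.
Qed.

Lemma sum_walks_to d l v : diregular e d -> \sum_u nwalks e l u v = d ^ l.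
Proof.
move=> reg; elim: l => [|l IHl].
  under eq_bigr do rewrite nwalks0.
  by rewrite (bigD1 v) //= eqxx big1 // => u /negPf->.
under eq_bigr do rewrite nwalksS.
rewrite (exchange_big_dep xpredT) //= expnS -IHl big_distrr /=.
by apply: eq_bigr => w _; rewrite sum_nat_const -(reg w).2 cardsE.
Qed.

Lemma unique_excess (f : T -> nat) :
  (forall x, 0 < f x) -> \sum_x f x = #|T|.+1 ->
  exists2 x, f x = 2 & forall y, 1 < f y -> y = x.
Proof.
move=> f_gt0; have -> : \sum_x f x = \sum_x (f x).-1 + #|T|.
  by rewrite -sum1_card -big_split /=; apply: eq_bigr => x _; rewrite addn1 prednK.
rewrite -add1n => /addIn sum1.
have [x fx] : exists x, 0 < (f x).-1.
  apply/existsP/contraT; rewrite negb_exists => /forallP fle.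
  move: sum1; rewrite big1 // => y _; apply/eqP; rewrite -leqn0 leqNgt; exact: fle.
move: sum1; rewrite (bigD1 x) //=; case fx1: (f x).-1 fx => [//|m] _.
rewrite addSn => -[] /eqP; rewrite addn_eq0 sum_nat_eq0 => /andP[/eqP m0 /forall_inP z].
exists x => [|y fy]; first by rewrite -(prednK (f_gt0 x)) fx1 m0.
apply/eqP/contraT=> /z; by case: (f y) fy => [|[]].
Qed.

Lemma nwalks_extend l u v x :
  e v x -> nwalks e l u v <= nwalks e l.+1 u x.
Proof.
move=> evx; elim: l u => [|l IHl] u.
  rewrite nwalks0; case: eqVneq => // ->.
  by rewrite nwalksS (bigD1 x) //= nwalks0 eqxx.
by rewrite nwalksS [leqRHS]nwalksS; apply: leq_sum.
Qed.

Lemma nwalks_le_gt0 k u v : has_diameter e k -> 0 < nwalks_le e k u v.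
Proof.
case=> /(_ u v)[n [[p pP sz_p] _] len] _.
rewrite /nwalks_le (bigD1_seq n) ?iota_uniq ?mem_index_iota //=.
rewrite ltn_addr // card_gt0; apply/set0Pn.
by exists (Tuple (introT eqP sz_p)); rewrite inE.
Qed.

Variables (d k : nat).
Hypothesis G : dk_digraph e d k.

Lemma sum_expn_order : \sum_(0 <= l < k.+1) d ^ l = #|T|.+1.
Proof. by rewrite big_ltn // (dk_order G). Qed.

Lemma excess_from u :
  exists2 v, nwalks_le e k u v = 2 & forall w, 1 < nwalks_le e k u w -> w = v.
Proof.
apply: unique_excess => [v|]; first exact: nwalks_le_gt0 (dk_diameter G).
rewrite exchange_big /= -sum_expn_order; apply: eq_bigr => l _.
exact: sum_walks_from (dk_diregular G).
Qed.

Lemma excess_to v :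
  exists2 u, nwalks_le e k u v = 2 & forall w, 1 < nwalks_le e k w v -> w = u.
Proof.
apply: unique_excess => [u|]; first exact: nwalks_le_gt0 (dk_diameter G).
rewrite exchange_big /= -sum_expn_order; apply: eq_bigr => l _.
exact: sum_walks_to (dk_diregular G).
Qed.

Lemma nwalks_le_bounds u v : 0 < nwalks_le e k u v <= 2.
Proof.
rewrite (nwalks_le_gt0 _ _ (dk_diameter G)) /=; have [w w2 wU] := excess_from u.
by rewrite leqNgt; apply/negP => gt2; move: (gt2); rewrite (wU v (ltnW gt2)) w2.
Qed.

Lemma exists_repeat u : exists2 v, is_repeat e k u v & forall w, is_repeat e k u w -> w = v.
Proof.
have [v v2 vU] := excess_from u; exists v; last first.
  by move=> w /andP[/eqP w2 _]; apply: vU; rewrite w2.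
rewrite /is_repeat v2 eqxx lt0n /=; apply/eqP => walk0.
have out_v x : e v x -> x = v.
  move=> evx; apply: vU; rewrite -v2 /nwalks_le big_nat_recr //= walk0 addn0.
  rewrite [leqRHS]big_ltn // big_add1 /= (leq_trans _ (leq_addl _ _)) //.
  by apply: leq_sum => l _; apply: nwalks_extend.
have := dk_degree_gt1 G; rewrite ltnNge -((dk_diregular G) v).1.
rewrite -[in X in _ <= X](cards1 v) => /negP[]; apply: subset_leq_card.
by apply/subsetP => x; rewrite !inE => /out_v->.
Qed.

Lemma repeatP u : is_repeat e k u (repeat e k u).
Proof.
rewrite /repeat; case: pickP => //= none.
by have [v] := exists_repeat u; rewrite none.
Qed.

Lemma repeat_unique u v : is_repeat e k u v -> v = repeat e k u.
Proof.
by have [w _ wU] := exists_repeat u => /wU->; rewrite (wU _ (repeatP u)).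
Qed.

Lemma repeat_inj : injective (repeat e k).
Proof.
move=> u v eq_uv; have [w _ wU] := excess_to (repeat e k u).
have /andP[/eqP u2 _] := repeatP u; have /andP[/eqP v2 _] := repeatP v.
by rewrite (wU u) ?u2 // (wU v) // eq_uv v2.
Qed.

Definition repeat_perm : {perm T} := perm repeat_inj.

End RepeatPermutation.

Section CycleStructure.
Variable T : finType.

Lemma perm_returns (s : {perm T}) (v : T) :
  exists t, (0 < t) && ((s ^+ t)%g v == v).
Proof. by exists #[s]%g; rewrite order_gt0 expg_order perm1 eqxx. Qed.

Definition vertex_order (s : {perm T}) (v : T) : nat := ex_minn (perm_returns s v).

(* The components of index 0 and of index > #|T| are zero. *)
Definition cycle_structure (s : {perm T}) (n : nat) : nat :=
  #|[set c in porbits s | #|c| == n]|.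

End CycleStructure.

(* Only finitely many m j are nonzero, so the indices j > 1 with m j != 0      *)
(* cannot exhaust all the 2 ^ t * alpha; they are among these, and alpha       *)
(* (t = 0) is the least of them. The condition m alpha != 0 is what makes      *)
(* alpha well determined; it is no extra restriction, by two_critical_weaken.  *)
Definition two_critical (m : nat -> nat) : Prop :=
  exists! alpha : nat,
    [/\ 1 < alpha, m alpha != 0
      & forall j, 1 < j -> m j != 0 -> exists t, j = 2 ^ t * alpha].

Lemma two_critical_weaken (m : nat -> nat) :
  (exists! alpha : nat, 1 < alpha /\
     forall j, 1 < j -> m j != 0 -> exists t, j = 2 ^ t * alpha) ->
  two_critical m.
Proof.
case=> a [[a_gt1 aP] aU]; exists a; split=> [|b [b_gt1 _ bP]]; last exact: aU.
split=> //; apply/negP=> /eqP ma0.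
have : a = 2 * a.
  apply: aU; split=> [|j j_gt1 mj]; first by rewrite (leq_trans a_gt1) ?leq_pmull.
  have [[|t] jE] := aP j j_gt1 mj; first by move: mj; rewrite jE mul1n ma0.
  by exists t; rewrite jE expnSr mulnA.
by move/eqP; rewrite -[X in X == _]mul1n eqn_pmul2r // ltnW.
Qed.

(* Main.v *)
Require Import Defs.
From mathcomp Require Import all_boot all_fingroup.

Set Implicit Arguments.
Unset Strict Implicit.
Unset Printing Implicit Defensive.

(** Let [z] be a self-repeat and [f = r ^+ p] a power of the repeat automorphism
    that fixes every out-neighbour of [z]. A walk of length [<= k] between
    [f]-fixed vertices [u] and [v <> r u] is unique, hence fixed vertex by vertex.
    If [v] is fixed and not an out-neighbour of [z], a walk [z -> w -> ... -> x]
    to an in-neighbour [x] of [v] yields such a walk [w -> ... -> x -> v], since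
    [r] preserves the out-neighbours of [z]; so [x] is fixed. The dual statement
    then holds for out-neighbours, and the two force [f] to be the identity.
    On the out-neighbours of [z] the orders are [1] or [2 ^ t * alpha], hence
    ordered by divisibility, so [p] can be taken to be the largest of them. It
    is at most [d - 1] because [r] fixes the out-neighbour of [z] on the unique
    closed walk of length [k] through [z]. *)

(** * Counting walks through explicit lists of walks *)

Section WalkCounting.
Variables (T : finType) (e : rel T).

Lemma nwalksSr l u v : nwalks e l.+1 u v = \sum_(w | e w v) nwalks e l u w.
Proof.
elim: l u => [|l IHl] u.
  rewrite nwalksS; under eq_bigr do rewrite nwalks0.
  under [RHS]eq_bigr do rewrite nwalks0.
  rewrite big_mkcond [RHS]big_mkcond /= (bigD1 v) //= [RHS](bigD1 u) //= !eqxx.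
  rewrite !big1 // => w /negPf; first by rewrite eq_sym => ->; rewrite if_same.
  by move->; rewrite if_same.
rewrite nwalksS (eq_bigr _ (fun w _ => IHl w)) exchange_big /=.
by apply: eq_bigr => w _; rewrite -nwalksS.
Qed.

(** Splitting [s] by length bounds each class separately; exhibiting distinct walks then contradicts
    an upper bound on the count. *)
Lemma size_uniq_walks k u v (s : seq (seq T)) :
  uniq s -> all (fun p => is_walk e u v p && (size p <= k)) s ->
  size s <= nwalks_le e k u v.
Proof.
move=> uniq_s /allP walk_s.
have -> : size s = \sum_(0 <= l < k.+1) count (fun p => size p == l) s.
  rewrite -sum1_size; under [RHS]eq_bigr do rewrite -sum1_count big_mkcond /=.
  rewrite exchange_big /=; apply: eq_big_seq => p /walk_s /andP[_ szp].
  rewrite -big_mkcond /= big_mkord (big_pred1 (Ordinal (szp : size p < k.+1))) //.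
apply: leq_sum => l _; rewrite -size_filter /nwalks cardE.
(* [nwalks] counts tuples; this cast loses nothing, as all of [t] has length [l]. *)
set t := filter _ s; pose t' : seq (l.-tuple T) := pmap insub t.
have -> : size t = size t'.
  rewrite size_pmap_sub; apply/esym/eqP; rewrite -all_count.
  by apply/allP => p; rewrite mem_filter => /andP[].
apply: uniq_leq_size; first exact/pmap_sub_uniq/filter_uniq.
move=> p; rewrite mem_pmap_sub mem_filter => /andP[_ /walk_s /andP[walk_p _]].
by rewrite mem_enum inE.
Qed.

Lemma is_walk_map (f : T -> T) u v p :
  {mono f : x y / e x y} -> is_walk e u v p -> is_walk e (f u) (f v) (map f p).
Proof.
by move=> fE /andP[p_path /eqP <-]; rewrite /is_walk (mono_path fE) p_path last_map /=.
Qed.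

End WalkCounting.

(** * The repeat automorphism and closed walks at self-repeats *)

Section AlmostMoore.
Variables (T : finType) (e : rel T) (d k : nat).
Hypothesis G : dk_digraph e d k.
Let r := repeat_perm G.

Lemma nwalks_leE u v : nwalks_le e k u v = 1 + (v == r u).
Proof.
have /andP[/eqP r2 _] := repeatP G u; rewrite permE.
have [->|neq] := eqVneq v; first by rewrite r2.
have /andP[w_gt0 _] := nwalks_le_bounds G u v.
apply/eqP; rewrite eqn_leq w_gt0 andbT leqNgt; apply/negP => gt1.
have [w _ wU] := excess_from G u.
by case/eqP: neq; rewrite (wU v gt1) (wU (repeat e k u)) ?r2.
Qed.

(* In matrix form the previous lemma reads I + A + ... + A^k = J + P; the left
   side and J commute with A, hence so does P. *)
Lemma repeat_perm_mono : {mono r : x y / e x y}.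
Proof.
move=> x y; have reg := dk_diregular G.
have : \sum_(w | e x w) nwalks_le e k w (r y)
     = \sum_(w | e w (r y)) nwalks_le e k x w.
  rewrite /nwalks_le exchange_big [RHS]exchange_big /=; apply: eq_bigr => l _.
  by rewrite -nwalksS -nwalksSr.
under eq_bigr do rewrite nwalks_leE.
under [RHS]eq_bigr do rewrite nwalks_leE.
rewrite !big_split /= !sum1_card -[in X in X + _]cardsE (reg x).1.
rewrite -[in X in _ = X + _]cardsE (reg (r y)).2 => /addnI.
rewrite big_mkcond [RHS]big_mkcond /= (bigD1 y) //= [RHS](bigD1 (r x)) //= !eqxx.
rewrite !big1 => [|w /negPf|w /negPf]; last first.
- by rewrite eq_sym (inj_eq perm_inj) eq_sym => ->; rewrite if_same.
- by move->; rewrite if_same.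
by do 2!case: (e _ _).
Qed.

Lemma repeat_perm_expg_mono n : {mono (r ^+ n)%g : x y / e x y}.
Proof.
elim: n => [|n IHn] x y; first by rewrite expg0 !perm1.
by rewrite expgS !permM IHn repeat_perm_mono.
Qed.

Lemma exists_walk u v : exists2 p, is_walk e u v p & size p <= k.
Proof.
by have [/(_ u v)[n [[p pP <-] _] len] _] := dk_diameter G; exists p.
Qed.

Lemma two_walks u v p q :
  is_walk e u v p -> is_walk e u v q -> size p <= k -> size q <= k ->
  p <> q -> v = r u.
Proof.
move=> pP qP szp szq /eqP neq; apply/eqP.
have := @size_uniq_walks _ e k u v [:: p; q]; rewrite /= inE neq pP qP szp szq.
by move/(_ isT isT); rewrite nwalks_leE; case: eqP.
Qed.

(** At a self-repeat the count is 2, and the empty walk takes one of the two places. *)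
Lemma closed_walk_unique z p q : r z = z ->
  is_walk e z z p -> is_walk e z z q -> size p <= k -> size q <= k ->
  p <> [::] -> q <> [::] -> p = q.
Proof.
move=> rz pP qP szp szq /eqP p0 /eqP q0; apply/eqP; apply/contraT => neq.
have := @size_uniq_walks _ e k z z [:: [::]; p; q].
rewrite /= !inE neq pP qP szp szq negb_or ![[::] == _]eq_sym p0 q0.
by rewrite {1}/is_walk /= eqxx nwalks_leE rz eqxx => /(_ isT isT).
Qed.

Lemma self_repeat_cycle z : r z = z ->
  exists p, [/\ is_walk e z z p, size p = k & map r p = p].
Proof.
move=> rz; have /andP[_] := repeatP G z; rewrite -(permE (repeat_inj G)) -/r rz.
rewrite card_gt0 => /set0Pn[p]; rewrite inE => pP; exists p.
have szp : size p = k by rewrite size_tuple.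
have p0 : tval p <> [::].
  by move=> p0; have := dk_diameter_gt1 G; rewrite -szp p0.
split=> //; apply: (@closed_walk_unique z) => //.
- by have := is_walk_map repeat_perm_mono pP; rewrite rz.
- by rewrite size_map szp.
- by rewrite szp.
- by case: (tval p) p0.
Qed.

Lemma self_repeat_succ z : r z = z -> exists2 b, e z b & r b = b.
Proof.
move=> rz; have [[|b p] [pP szp rp]] := self_repeat_cycle rz.
  by have := dk_diameter_gt1 G; rewrite -szp.
case/andP: pP => /= /andP[ezb _] _; case: rp => rb _.
by exists b.
Qed.

(** Here [c] precedes [z] on the closed walk of length [k]: appending [z] to [q] gives a nonempty
    closed walk, which must be that one. *)
Lemma self_repeat_pred z : r z = z ->
  exists c, [/\ e c z, r c = c &
    forall x q, is_walk e z x q -> size q < k -> e x z -> x = c /\ (size q).+1 = k].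
Proof.
move=> rz; have [p [pP szp rp]] := self_repeat_cycle rz.
have k_gt1 := dk_diameter_gt1 G.
case/lastP: p pP szp rp => [|p y] pP szp rp; first by rewrite -szp in k_gt1.
move: (pP); rewrite /is_walk rcons_path last_rcons => /andP[/andP[_ ecz] /eqP yz].
subst y; exists (last z p); split=> //.
  by rewrite -(last_map r) rz; move: rp; rewrite map_rcons => /rcons_inj[->].
move=> x q /andP[q_path /eqP qx] szq exz.
have /rcons_inj[qp] : rcons q z = rcons p z.
  apply: (@closed_walk_unique z) => //.
  - by rewrite /is_walk rcons_path last_rcons q_path qx exz eqxx.
  - by rewrite size_rcons.
  - by rewrite szp.
  - by case: (q).
  - by case: (p).
by rewrite -qx qp -szp size_rcons.
Qed.

(** * Adjacency-preserving maps fixing a self-repeat and its out-neighbours *)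

Section FixedVertices.
Variables (f : T -> T) (z : T).
Hypothesis f_mono : {mono f : x y / e x y}.
Hypothesis rz : r z = z.
Hypothesis fz : f z = z.
Hypothesis f_succ : forall w, e z w -> f w = w.

Lemma fixed_walk u v p x :
  f u = u -> f v = v -> v <> r u -> is_walk e u v p -> size p <= k ->
  x \in p -> f x = x.
Proof.
move=> fu fv vru pP szp.
suff fp : map f p = p.
  move=> /(nthP x)[i ltip <-]; by rewrite -{2}fp (nth_map x).
have [//|/eqP neq] := eqVneq (map f p) p; case: vru.
apply: (two_walks _ pP _ szp neq); last by rewrite size_map.
by have := is_walk_map f_mono pP; rewrite fu fv.
Qed.

Lemma fixed_pred v x : f v = v -> ~~ e z v -> e x v -> f x = x.
Proof.
move=> fv nezv exv; have [[|w p] /andP[/= pP /eqP px] szp] := exists_walk z x.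
  by rewrite px exv in nezv.
case/andP: pP => ezw pP.
have : x \in w :: rcons p v by rewrite -px -rcons_cons mem_rcons inE mem_last orbT.
rewrite inE => /predU1P[->|]; first exact: f_succ.
apply: (fixed_walk (f_succ ezw) fv).
- by move=> vE; case/negP: nezv; rewrite vE -rz repeat_perm_mono.
- by rewrite /is_walk rcons_path last_rcons pP px exv eqxx.
- by rewrite size_rcons.
Qed.

Lemma fixed_succ v x : f v = v -> ~~ e v z -> e v x -> f x = x.
Proof.
move=> fv nevz evx; have [p pP szp] := exists_walk x z.
case/lastP: p pP szp => [|p y]; rewrite /is_walk ?rcons_path ?last_rcons /=.
  by move/eqP=> xz; rewrite -xz evx in nevz.
rewrite size_rcons => /andP[/andP[pP ewz] /eqP yz] szp; subst y.
have nezz : ~~ e z z.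
  have [c [_ _ cP]] := self_repeat_pred rz; apply/negP => ezz.
  have [|_ /= k1] := cP z [::] _ (ltnW (dk_diameter_gt1 G)) ezz.
    by rewrite /is_walk /=.
  by have := dk_diameter_gt1 G; rewrite -k1.
(* Trading the final arc into [z] for the initial arc from [v] keeps the length at most [k]. *)
apply: (@fixed_walk v (last x p) (x :: p)) => //; last exact: mem_head.
- exact: fixed_pred fz nezz ewz.
- by move=> wE; case/negP: nevz; rewrite -repeat_perm_mono rz -wE.
- by rewrite /is_walk /= evx pP eqxx.
Qed.

(** Every moved vertex is an out-neighbour of [c]. A moved [v] would have a moved out-neighbour [y],
    so that [c -> y] and [c -> v -> y] force [y = r c = c], a fixed vertex. *)
Lemma fixes_succ_id v : f v = v.
Proof.
have [c [ecz rc cP]] := self_repeat_pred rz.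
have szk2 (x y : T) : size [:: x; y] <= k by apply: dk_diameter_gt1 G.
(* A moved predecessor would already be at length [k], leaving no room for another arc; a fixed one
   must have an arc to [z], hence is [c]. *)
have nfix_walk p : path e z p -> size p <= k -> f (last z p) <> last z p ->
    size p = k /\ e c (last z p).
  elim/last_ind: p => [|p y IHp] //=.
  rewrite rcons_path last_rcons size_rcons => /andP[pP epy] szp fy.
  have [fx|/eqP fx] := eqVneq (f (last z p)) (last z p); last first.
    by have [|szk _] := IHp pP _ fx; [exact: ltnW | rewrite -szk ltnn in szp].
  have exz : e (last z p) z by apply/contraT => nexz; case: fy; apply: fixed_succ fx nexz epy.
  have [|<- ->] := cP (last z p) p _ szp exz; last by [].
  by rewrite /is_walk pP eqxx.
have nfix_c y : f y <> y -> e c y.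
  move=> fy; have [p /andP[pP /eqP pE] szp] := exists_walk z y.
  by have [] := nfix_walk p pP szp; rewrite pE.
have fc : f c = c.
  have [//|/eqP fc] := eqVneq (f c) c.
  (* A loop at [c] gives nonempty closed walks of lengths 1 and 2 at a self-repeat. *)
  have ecc := nfix_c _ fc.
  have := @closed_walk_unique c [:: c] [:: c; c] rc; rewrite /is_walk /= ecc eqxx.
  by move=> /(_ isT isT (ltnW (dk_diameter_gt1 G)) (dk_diameter_gt1 G)) H; discriminate H.
have [//|/eqP fv] := eqVneq (f v) v.
have ecv := nfix_c _ fv.
have vz : v <> z by move=> vz; rewrite vz fz in fv.
have [y evy] : exists y, e v y.
  have : 0 < #|[set w | e v w]|.
    by rewrite (dk_diregular G v).1 ltnW // (dk_degree_gt1 G).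
  by rewrite card_gt0 => /set0Pn[y]; rewrite inE => evy; exists y.
have walk_vy : is_walk e c y [:: v; y] by rewrite /is_walk /= ecv evy eqxx.
(* Otherwise [c -> v -> y] and [c -> z -> y] give [y = r c = c], hence two closed walks at [c]. *)
have nezy : ~~ e z y.
  apply/negP => ezy.
  have walk_zy : is_walk e c y [:: z; y] by rewrite /is_walk /= ecz ezy eqxx.
  have yc : y = c.
    rewrite -rc; apply: (two_walks walk_vy walk_zy) => //.
    by case.
  subst y.
  suff [] : [:: v; c] = [:: z; c] by [].
  exact: closed_walk_unique rc walk_vy walk_zy (szk2 _ _) (szk2 _ _) _ _.
have fy : f y <> y by move=> fy; case: fv; apply: fixed_pred fy nezy evy.
have yc : y = r c.
  apply: (@two_walks c y [:: y] [:: v; y]) => //.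
    by rewrite /is_walk /= (nfix_c _ fy) eqxx.
  exact: ltnW (dk_diameter_gt1 G).
by case: fy; rewrite yc rc.
Qed.

End FixedVertices.

Lemma porbit_succ_self_repeat z w : r z = z -> e z w -> #|porbit r w| <= d - 1.
Proof.
move=> rz ezw; have [b ezb rb] := self_repeat_succ rz.
(* The orbit of [b] is a singleton, and [1 <= d - 1]; any other orbit stays among the out-neighbours
   of [z] and avoids [b]. *)
have [wb|wb] := eqVneq w b.
  rewrite (_ : porbit r w = [set w]); last first.
    apply/setP=> x; rewrite inE; apply/porbitP/eqP => [[i ->]|->]; last first.
      by exists 0; rewrite expg0 perm1.
    by rewrite wb permX; elim: i => //= i ->.
  by rewrite cards1 subn_gt0 (dk_degree_gt1 G).
have <- : #|[set x | e z x] :\ b| = d - 1.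
  by rewrite -(dk_diregular G z).1 (cardsD1 b [set x | e z x]) inE ezb addKn.
apply/subset_leq_card/subsetP => x /porbitP[i ->]; rewrite !inE; apply/andP; split.
  have -> : b = (r ^+ i)%g b by rewrite permX; elim: i => //= i <-.
  by rewrite (inj_eq perm_inj).
have -> : z = (r ^+ i)%g z by rewrite permX; elim: i => //= i <-.
by rewrite repeat_perm_expg_mono.
Qed.

End AlmostMoore.

(** * Orbit lengths and powers of a permutation *)

Section PermOrder.
Variables (T : finType) (s : {perm T}).

Lemma expg_card_porbit v n : #|porbit s v| %| n -> (s ^+ n)%g v = v.
Proof.
case/dvdnP=> m ->; rewrite permX iterM; elim: m => //= m ->.
exact: iter_porbit.
Qed.

Lemma vertex_order_le v n : 0 < n -> (s ^+ n)%g v = v -> vertex_order s v <= n.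
Proof.
move=> n_gt0 sv; rewrite /vertex_order; case: ex_minnP => m _; apply.
by rewrite n_gt0 sv eqxx.
Qed.

Lemma two_critical_dvdn v w :
  two_critical (cycle_structure s) -> #|porbit s v| <= #|porbit s w| ->
  #|porbit s v| %| #|porbit s w|.
Proof.
case=> a [[a_gt1 _ aP] _].
have card_porbit x : #|porbit s x| = 1 \/ exists t, #|porbit s x| = 2 ^ t * a.
  have : 0 < #|porbit s x| by rewrite card_gt0; apply/set0Pn; exists x; apply: porbit_id.
  rewrite leq_eqVlt => /predU1P[<-|gt1]; [by left | right].
  apply: aP gt1 _; rewrite -lt0n card_gt0; apply/set0Pn; exists (porbit s x).
  by rewrite inE eqxx andbT imset_f.
have [-> _|[t ->]] := card_porbit v; first exact: dvd1n.
have [->|[t' ->]] := card_porbit w.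
  by rewrite leqNgt (leq_trans a_gt1) // leq_pmull // expn_gt0.
rewrite leq_pmul2r ?(ltnW a_gt1) // leq_exp2l // => le_tt'.
by rewrite dvdn_mul // dvdn_exp2l.
Qed.

End PermOrder.

Theorem theorem2 (T : finType) (e : rel T) (d k : nat) (G : dk_digraph e d k) :
  (exists z : T, repeat_perm G z = z) ->
  two_critical (cycle_structure (repeat_perm G)) ->
  forall v : T, vertex_order (repeat_perm G) v <= d - 1.
Proof.
move=> [z rz] crit v; set r := repeat_perm G in rz crit *.
have [b ezb _] := self_repeat_succ rz.
have [w ezw wmax] := @arg_maxnP T b (e z) (fun x => #|porbit r x|) ezb.
apply: leq_trans (porbit_succ_self_repeat rz ezw); apply: vertex_order_le.
  by rewrite card_gt0; apply/set0Pn; exists w; apply: porbit_id.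
(* The map [f] is the power of [r] with exponent [#|porbit r w|]. *)
apply: (fixes_succ_id (repeat_perm_expg_mono _ _) rz).
  by rewrite permX; elim: #|_| => //= n ->.
by move=> x ezx; apply/expg_card_porbit/two_critical_dvdn/wmax.
Qed.
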